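(* Let $n\ge2$, let $E_1,\dots,E_n$ be Banach spaces over $\mathbb{K}$, and let $\mu:\bigotimes_{i=1}^nE_i\to\mathbb{K}$ be a multiple Grothendieck integral with corresponding continuous $n$-linear form $\varphi:E_1\times\cdots\times E_n\to\mathbb{K}$, $\varphi(e_1,\dots,e_n)=\mu(e_1\otimes\cdots\otimes e_n)$. Then for any $1\le k\le n$ there exists a bounded linear operator $$T^{(k)}:E_k\to\Bigl(\bigotimes_{\pi,\,i\ne k}E_i\Bigr)^*$$ satisfying $$T^{(k)}(e_k)(e_1\otimes\cdots\otimes e_{k-1}\otimes e_{k+1}\otimes\cdots\otimes e_n)=\varphi(e_1,\dots,e_n)$$ for all $e_i\in E_i$, and $\|T^{(k)}\|\le K_G^{n-1}$. Furthermore, for any permutation $\sigma\in S_n$ and all $e_i\in E_i$, the value $\mu(e_1\otimes\cdots\otimes e_n)$ equals the scalar obtained by iterated partial integration in the order $\sigma(1),\dots,\sigma(n)$: first fix $e_{\sigma(1)}$ to obtain the functional $T^{(\sigma(1))}(e_{\sigma(1)})$ on the projective tensor product of the remaining spaces, then fix $e_{\sigma(2)}$ in that functional to obtain a functional on the projective tensor product of the spaces still remaining, and so forth, until $e_{\sigma(n)}$ has been inserted.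
   Context: $\mathbb{K}$ is $\mathbb{R}$ or $\mathbb{C}$. $K_G$ denotes Grothendieck's constant for the field $\mathbb{K}$: the smallest $K$ such that for all $m\ge1$ and all $m\times m$ matrices $(a_{ij})$ over $\mathbb{K}$ with $|\sum a_{ij}s_it_j|\le 1$ for all scalars $|s_i|,|t_j|\le1$, one has $|\sum a_{ij}\langle x_i,y_j\rangle|\le K$ for all vectors $x_i,y_j$ in the unit ball of any Hilbert space over $\mathbb{K}$. On the algebraic tensor product $\bigotimes_{i=1}^nE_i$ the (multiple) projective norm is $\|u\|_\pi=\inf\{\sum_{k=1}^m\|e_1^k\|_{E_1}\cdots\|e_n^k\|_{E_n}: u=\sum_{k=1}^m e_1^k\otimes\cdots\otimes e_n^k\}$, and $\bigotimes_{\pi}E_i$ denotes the completion in this norm. A linear functional $\mu:\bigotimes_{i=1}^nE_i\to\mathbb{K}$ is a multiple Grothendieck integral if there is a constant $C\le K_G^{n-1}$ with $|\mu(x)|\le C\|x\|_\pi$ for all $x\in\bigotimes_{i=1}^nE_i$. Fixing a vector $e_j\in E_j$ in a functional $\nu$ on the projective tensor product of a family of spaces including $E_j$ means passing to the functional on the projective tensor product of the other spaces of the family that sends an elementary tensor $\bigotimes_{i\ne j}e_i$ to the value of $\nu$ at the elementary tensor with $e_j$ inserted in its slot. *)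

(* Defs.v *)
From HB Require Import structures.
From mathcomp Require Import all_boot all_order all_algebra.
From mathcomp Require Import sesquilinear complex.
From mathcomp Require Import all_classical all_reals all_analysis.

Set Implicit Arguments.
Unset Strict Implicit.
Unset Printing Implicit Defensive.

Import Order.TTheory GRing.Theory Num.Theory.
Import numFieldNormedType.Exports.

Local Open Scope classical_set_scope.
Local Open Scope ring_scope.

Variant scalar_kind := RealScalars | ComplexScalars.

Definition scalars (R : realType) (k : scalar_kind) : numFieldType :=
  match k with RealScalars => R | ComplexScalars => R[i]%C end.

Definition conjS (R : realType) (k : scalar_kind) :
    scalars R k -> scalars R k :=
  match k with RealScalars => idfun | ComplexScalars => @conjc R end.

Definition reS (R : realType) (k : scalar_kind) : scalars R k -> R :=
  match k with RealScalars => idfun | ComplexScalars => @complex.Re R end.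

Definition realS (R : realType) (k : scalar_kind) : R -> scalars R k :=
  match k with RealScalars => idfun | ComplexScalars => real_complex R end.

Arguments realS R k : clear implicits.

(* Norms over the numFieldType [scalars R k] take their values in that field;
   [rnorm] is the same norm, with values in [R]. *)
Definition rnorm (R : realType) (k : scalar_kind)
    (V : normedZmodType (scalars R k)) (x : V) : R := reS `|x|.

Section ScalarTheory.
Variables (R : realType) (k : scalar_kind).
Local Notation S := (scalars R k).
Local Notation inj := (realS R k).

Lemma realSK r : reS (inj r) = r. Proof. by case: k. Qed.

Lemma reSK (a : S) : 0 <= a -> inj (reS a) = a.
Proof.
case: k a => //= -[x y]; rewrite lecE /= => /andP[/eqP/= y0 _].
by rewrite /real_complex_def y0.
Qed.

Lemma realSD r s : inj (r + s) = inj r + inj s.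
Proof. by case: k => //=; rewrite rmorphD. Qed.

Lemma realSM r s : inj (r * s) = inj r * inj s.
Proof. by case: k => //=; rewrite rmorphM. Qed.

Lemma realS0 : inj 0 = 0. Proof. by case: k. Qed.

Lemma realS1 : inj 1 = 1. Proof. by case: k. Qed.

Lemma ler_realS r s : (inj r <= inj s) = (r <= s).
Proof. by case: k => //=; rewrite lecR. Qed.

Lemma ltr_realS r s : (inj r < inj s) = (r < s).
Proof. by case: k => //=; rewrite ltcR. Qed.

Section Rnorm.
Variable V : normedZmodType S.
Implicit Types x y : V.

Lemma realS_rnorm x : inj (rnorm x) = `|x|.
Proof. by rewrite /rnorm reSK. Qed.

Lemma rnorm_ge0 x : 0 <= rnorm x.
Proof. by rewrite -ler_realS realS_rnorm realS0. Qed.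

Lemma rnormD x y : rnorm (x + y) <= rnorm x + rnorm y.
Proof. by rewrite -ler_realS realSD !realS_rnorm ler_normD. Qed.

Lemma rnorm0_eq0 x : rnorm x = 0 -> x = 0.
Proof. by move=> x0; apply: normr0_eq0; rewrite -realS_rnorm x0 realS0. Qed.

Lemma rnorm0 : rnorm (0 : V) = 0.
Proof. by rewrite -[LHS]realSK realS_rnorm normr0 -realS0 realSK. Qed.

End Rnorm.

Lemma rnormZ (V : normedModType S) (a : S) (x : V) :
  rnorm (a *: x) = rnorm a * rnorm x.
Proof. by rewrite -[LHS]realSK realS_rnorm normrZ -!realS_rnorm -realSM realSK. Qed.

Lemma rnormM (a b : S) : rnorm (a * b) = rnorm a * rnorm b.
Proof. by rewrite -[LHS]realSK realS_rnorm normrM -!realS_rnorm -realSM realSK. Qed.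

Lemma rnorm1 : rnorm (1 : S) = 1.
Proof. by rewrite -[LHS]realSK realS_rnorm normr1 -realS1 realSK. Qed.

Lemma rnorm_realS r : 0 <= r -> rnorm (inj r) = r.
Proof.
move=> r0; rewrite -[LHS]realSK realS_rnorm ger0_norm ?realSK//.
by rewrite -realS0 ler_realS.
Qed.

End ScalarTheory.

Section BoundedOperators.
Variables (R : realType) (k : scalar_kind).
Local Notation S := (scalars R k).
Variables (X Y : normedModType S).

Definition bounded_linear : {pred X -> Y} := fun f =>
  `[< linear f /\ exists M : R, forall x, rnorm (f x) <= M * rnorm x >].

Fact bounded_linear_submod : submod_closed bounded_linear.
Proof.
split=> [|a f g /asboolP[lf [M fM]] /asboolP[lg [N gN]]]; apply/asboolP; split.
- by move=> b x y; rewrite scaler0 addr0.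
- by exists 0 => x; rewrite mul0r rnorm0.
- move=> b x y; rewrite !fctE /= lf lg !scalerDr !scalerA [a * b]mulrC.
  by rewrite addrACA.
- exists (rnorm a * M + N) => x; rewrite !fctE (le_trans (rnormD _ _))//.
  by rewrite mulrDl lerD// rnormZ -mulrA ler_wpM2l ?rnorm_ge0.
Qed.

HB.instance Definition _ :=
  GRing.isSubmodClosed.Build S (X -> Y) bounded_linear bounded_linear_submod.

Record bounded_op := BoundedOp {
  bounded_op_fun :> X -> Y;
  _ : bounded_op_fun \in bounded_linear }.

HB.instance Definition _ := [isSub for bounded_op_fun].
HB.instance Definition _ := [Choice of bounded_op by <:].
HB.instance Definition _ := [SubChoice_isSubLmodule of bounded_op by <:].

Lemma bounded_op_linear (f : bounded_op) : linear f.
Proof. by have /asboolP[] := valP f. Qed.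

HB.instance Definition _ (f : bounded_op) :=
  GRing.isLinear.Build S X Y *:%R f (bounded_op_linear f).

Definition op_norm (f : bounded_op) : R :=
  sup [set rnorm (f x) | x in [set x | rnorm x <= 1]].

Lemma op_norm_has_sup (f : bounded_op) :
  has_sup [set rnorm (f x) | x in [set x | rnorm x <= 1]].
Proof.
split; first by exists (rnorm (f 0)), 0; rewrite //= rnorm0 ler01.
have /asboolP[_ [M fM]] := valP f; exists `|M| => _ [x /= x1 <-].
rewrite (le_trans (fM x))// (le_trans (ler_wpM2r (rnorm_ge0 _) (ler_norm M)))//.
by rewrite ler_piMr.
Qed.

Lemma op_norm_ge0 f : 0 <= op_norm f.
Proof.
apply: le_trans (ub_le_sup (op_norm_has_sup f).2 _); last first.
  by exists 0; rewrite //= rnorm0 ler01.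
exact: rnorm_ge0.
Qed.

Lemma op_norm_le (f : bounded_op) (x : X) : rnorm (f x) <= op_norm f * rnorm x.
Proof.
have [x0|xN0] := eqVneq (rnorm x) 0.
  by rewrite (rnorm0_eq0 x0) linear0 !rnorm0 mulr0.
have x_gt0 : 0 < rnorm x by rewrite lt_neqAle eq_sym xN0 rnorm_ge0.
rewrite -ler_pdivrMr// mulrC.
apply: (ub_le_sup (op_norm_has_sup f).2); exists (realS R k (rnorm x)^-1 *: x).
  by rewrite /= rnormZ rnorm_realS ?mulVf// invr_ge0 ltW.
by rewrite linearZ/= rnormZ rnorm_realS// invr_ge0 ltW.
Qed.

Lemma op_norm_le_bound (f : bounded_op) (C : R) : 0 <= C ->
  (forall x, rnorm (f x) <= C * rnorm x) -> op_norm f <= C.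
Proof.
move=> C0 fC; apply: ge_sup; first exact: (op_norm_has_sup f).1.
by move=> _ [x /= x1 <-]; rewrite (le_trans (fC x))// ler_piMr.
Qed.

Lemma op_normD f g : op_norm (f + g) <= op_norm f + op_norm g.
Proof.
apply: op_norm_le_bound => [|x]; first by rewrite addr_ge0 ?op_norm_ge0.
by rewrite (le_trans (rnormD _ _))// mulrDl lerD ?op_norm_le.
Qed.

Lemma op_normZ_le (a : S) f : op_norm (a *: f) <= rnorm a * op_norm f.
Proof.
apply: op_norm_le_bound => [|x].
  by rewrite mulr_ge0 ?op_norm_ge0 ?rnorm_ge0.
by rewrite [_ x]/= rnormZ -mulrA ler_wpM2l ?rnorm_ge0 ?op_norm_le.
Qed.

Lemma op_normZ (a : S) f : op_norm (a *: f) = rnorm a * op_norm f.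
Proof.
apply/eqP; rewrite eq_le op_normZ_le/=.
have [->|a0] := eqVneq a 0; first by rewrite rnorm0 mul0r op_norm_ge0.
have ra_gt0 : 0 < rnorm a.
  rewrite lt_neqAle rnorm_ge0 andbT eq_sym; apply: contra_neq a0.
  exact: rnorm0_eq0.
rewrite -{1}[f](scalerK a0) mulrC -ler_pdivlMr//.
rewrite (le_trans (op_normZ_le _ _))// mulrC ler_wpM2l ?op_norm_ge0//.
rewrite -(@ler_pM2r _ (rnorm a))// mulVf ?gt_eqF// -rnormM mulVf//.
by rewrite rnorm1.
Qed.

Lemma op_norm0_eq0 f : op_norm f = 0 -> f = 0.
Proof.
move=> f0; apply/val_inj/funext => x; apply: rnorm0_eq0; apply/eqP.
by rewrite eq_le rnorm_ge0 andbT (le_trans (op_norm_le f x))// f0 mul0r.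
Qed.

Let normS f : S := realS R k (op_norm f).

Let normSD f g : normS (f + g) <= normS f + normS g.
Proof. by rewrite -realSD ler_realS op_normD. Qed.

Let normSZ (a : S) f : normS (a *: f) = `|a| * normS f.
Proof. by rewrite /normS op_normZ realSM realS_rnorm. Qed.

Let normS0_eq0 f : normS f = 0 -> f = 0.
Proof.
rewrite -(realS0 R k) => /(congr1 (@reS R k)).
by rewrite !realSK; exact: op_norm0_eq0.
Qed.

HB.instance Definition _ :=
  Lmodule_isNormed.Build S bounded_op normSD normSZ normS0_eq0.

Lemma rnorm_bounded_op f : rnorm f = op_norm f.
Proof. by rewrite /rnorm [X in reS X]/(normS f) realSK. Qed.

End BoundedOperators.

Notation dual X := (bounded_op X (scalars _ _)^o).

Record seminorm (R : realType) (k : scalar_kind) (V : lmodType (scalars R k)) :=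
  Seminorm {
    seminorm_fun :> V -> R;
    seminormD : forall x y, seminorm_fun (x + y) <= seminorm_fun x + seminorm_fun y;
    seminormZ : forall (a : scalars R k) x,
      seminorm_fun (a *: x) = rnorm a * seminorm_fun x }.

(* Completion of a seminormed space: Cauchy sequences modulo null sequences. *)
Section Completion.
Variables (R : realType) (k : scalar_kind).
Local Notation S := (scalars R k).
Variables (V : lmodType S) (p : seminorm V).

Lemma seminorm0 : p 0 = 0.
Proof. by rewrite -(scale0r 0) seminormZ rnorm0 mul0r. Qed.

Lemma seminormN x : p (- x) = p x.
Proof.
rewrite -scaleN1r seminormZ; have -> : rnorm (-1 : S) = 1; last by rewrite mul1r.
by rewrite /rnorm normrN1 -(realS1 R k) realSK.
Qed.

Lemma seminormC x y : p (x - y) = p (y - x).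
Proof. by rewrite -opprB seminormN. Qed.

Lemma seminorm_ge0 x : 0 <= p x.
Proof.
have := seminormD p x (- x); rewrite subrr seminorm0 seminormN -mulr2n.
by rewrite pmulrn_lge0.
Qed.

Lemma seminorm_dist x y : `|p x - p y| <= p (x - y).
Proof.
rewrite ler_norml; apply/andP; split.
  rewrite lerNl opprB lerBlDr seminormC.
  by rewrite (le_trans _ (seminormD _ _ _))// subrK.
by rewrite lerBlDr (le_trans _ (seminormD _ _ _))// subrK.
Qed.

Definition is_cauchy : {pred nat -> V} := fun u =>
  `[< forall e : R, 0 < e -> exists N, forall m n,
        (N <= m)%N -> (N <= n)%N -> p (u m - u n) < e >].

Fact is_cauchy_submod : submod_closed is_cauchy.
Proof.
split=> [|a u v /asboolP uC /asboolP vC]; apply/asboolP => e e0.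
  by exists 0%N => m n _ _; rewrite subrr seminorm0.
have a0 : 0 < rnorm a + 1 by rewrite ltr_wpDl ?rnorm_ge0.
have [|N uN] := uC (e / 2 / (rnorm a + 1)); first by rewrite !divr_gt0.
have [|M vM] := vC (e / 2); first by rewrite divr_gt0.
exists (maxn N M) => m n; rewrite !geq_max => /andP[Nm Mm] /andP[Nn Mn].
rewrite !fctE opprD addrACA -scalerBr (le_lt_trans (seminormD _ _ _))//.
rewrite [e]splitr ler_ltD ?vM// seminormZ.
rewrite (le_trans (ler_wpM2l (rnorm_ge0 _) (ltW (uN _ _ Nm Nn))))//.
rewrite mulrCA ler_piMr ?divr_ge0 ?ltW// ltr_pdivrMr// mul1r ltrDl//.
Qed.

HB.instance Definition _ :=
  GRing.isSubmodClosed.Build S (nat -> V) is_cauchy is_cauchy_submod.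

Record cauchy_sequence := CauchySequence {
  cauchy_sequence_fun :> nat -> V;
  _ : cauchy_sequence_fun \in is_cauchy }.

HB.instance Definition _ := [isSub for cauchy_sequence_fun].
HB.instance Definition _ := [Choice of cauchy_sequence by <:].
HB.instance Definition _ := [SubChoice_isSubLmodule of cauchy_sequence by <:].

Definition is_null : {pred cauchy_sequence} := fun u =>
  `[< (fun n => p (u n)) @ \oo --> (0 : R) >].

Fact is_null_submod : submod_closed is_null.
Proof.
split=> [|a u v /asboolP u0 /asboolP v0]; apply/asboolP.
  rewrite [X in X @ _](_ : _ = cst 0); first exact: cvg_cst.
  by apply/funext => n; rewrite [_ n]/= seminorm0.
have upper : (fun n => rnorm a * p (u n) + p (v n)) @ \oo --> (0 : R).
  rewrite -[0]addr0; apply: cvgD => //.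
  by rewrite -(mulr0 (rnorm a)); apply: cvgM => //; exact: cvg_cst.
apply: squeeze_cvgr (cvg_cst 0) upper.
apply: nearW => n; rewrite seminorm_ge0/= -seminormZ.
exact: seminormD.
Qed.

HB.instance Definition _ :=
  GRing.isSubmodClosed.Build S cauchy_sequence is_null is_null_submod.

Definition completion := {ideal_quot is_null}.

HB.instance Definition _ := GRing.Zmodule.on completion.

Local Open Scope quotient_scope.

Lemma completion_eqP (u v : cauchy_sequence) :
  reflect ((fun n => p (u n - v n)) @ \oo --> (0 : R))
          (\pi_completion u == \pi_completion v).
Proof. by rewrite -Quotient.idealrBE; exact: asboolP. Qed.

Definition completion_scale (a : S) (x : completion) : completion :=
  \pi_completion (a *: repr x).

Lemma pi_completion_scale a u :
  completion_scale a (\pi_completion u) = \pi_completion (a *: u).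
Proof.
apply/eqP; rewrite /completion_scale -Quotient.idealrBE -scalerBr.
by rewrite rpredZ// Quotient.idealrBE reprK.
Qed.

Lemma pi_completionD u v :
  \pi_completion (u + v) = \pi_completion u + \pi_completion v.
Proof. by rewrite Quotient.pi_add. Qed.

Fact completion_scaleA a b x :
  completion_scale a (completion_scale b x) = completion_scale (a * b) x.
Proof. by rewrite -[x]reprK (pi_completion_scale b) !pi_completion_scale scalerA. Qed.

Fact completion_scale1 : left_id 1 completion_scale.
Proof. by move=> x; rewrite -[x]reprK pi_completion_scale scale1r. Qed.

Fact completion_scaleDr : right_distributive completion_scale +%R.
Proof.
move=> a x y; rewrite -[x]reprK -[y]reprK -pi_completionD.
by rewrite !pi_completion_scale scalerDr pi_completionD.
Qed.

Fact completion_scaleDl x : {morph completion_scale^~ x : a b / a + b}.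
Proof. by move=> a b /=; rewrite -[x]reprK !pi_completion_scale scalerDl pi_completionD. Qed.

HB.instance Definition _ :=
  GRing.Zmodule_isLmodule.Build S completion completion_scaleA
    completion_scale1 completion_scaleDr completion_scaleDl.

Definition completion_norm (x : completion) : R :=
  limn (fun n => p (repr x n)).

Lemma cauchy_sequenceP (u : cauchy_sequence) (e : R) : 0 < e ->
  exists N, forall m n, (N <= m)%N -> (N <= n)%N -> p (u m - u n) < e.
Proof. by have /asboolP := valP u; exact. Qed.

Lemma cvg_cauchy_sequence (u : cauchy_sequence) : cvgn (fun n => p (u n)).
Proof.
apply: R_complete; apply/cauchy_exP => e e0; have [N uN] := cauchy_sequenceP u e0.
exists (p (u N)); exists N => // n /= Nn.
by rewrite /ball/= (le_lt_trans (seminorm_dist _ _))// uN.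
Qed.

Arguments cvg_cauchy_sequence : clear implicits.

Lemma pi_completionZ (a : S) u :
  \pi_completion (a *: u) = a *: (\pi_completion u : completion).
Proof. by rewrite -pi_completion_scale. Qed.

Lemma pi_completionN u : \pi_completion (- u) = - (\pi_completion u : completion).
Proof. by rewrite Quotient.pi_opp. Qed.

Lemma completion_norm_pi u :
  completion_norm (\pi_completion u) = limn (fun n => p (u n)).
Proof.
have /completion_eqP d0 :
    \pi_completion (repr (\pi_completion u)) == \pi_completion u.
  by rewrite reprK.
apply/eqP; rewrite /completion_norm -subr_eq0 -limB//;
  try exact: cvg_cauchy_sequence.
apply/eqP/cvg_lim => //; apply/norm_cvg0P.
apply: squeeze_cvgr (cvg_cst 0) d0.
by apply: nearW => n; rewrite normr_ge0 seminorm_dist.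
Qed.

Lemma completion_normD x y :
  completion_norm (x + y) <= completion_norm x + completion_norm y.
Proof.
rewrite -[x]reprK -[y]reprK -pi_completionD !completion_norm_pi -limD;
  try exact: cvg_cauchy_sequence.
apply: ler_lim; first exact: cvg_cauchy_sequence.
  by apply: is_cvgD; exact: cvg_cauchy_sequence.
by apply: nearW => n; exact: seminormD.
Qed.

Lemma completion_normZ (a : S) x :
  completion_norm (a *: x) = rnorm a * completion_norm x.
Proof.
rewrite -[x]reprK -pi_completionZ !completion_norm_pi.
apply/cvg_lim => //.
rewrite [X in X @ _](_ : _ = (fun n => rnorm a * p (repr x n))); last first.
  by apply/funext => n; rewrite [_ n]/= seminormZ.
by apply: cvgM; [exact: cvg_cst|exact: cvg_cauchy_sequence].
Qed.

Lemma completion_norm0_eq0 x : completion_norm x = 0 -> x = 0.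
Proof.
rewrite -[x]reprK completion_norm_pi => x0; apply/eqP.
have -> : 0 = \pi_completion 0 :> completion by rewrite pi_zeror.
apply/completion_eqP; have := cvg_cauchy_sequence (repr x); rewrite x0 => cx.
by under eq_fun do rewrite subr0.
Qed.

Let normS x : S := realS R k (completion_norm x).

Let normSD x y : normS (x + y) <= normS x + normS y.
Proof. by rewrite -realSD ler_realS completion_normD. Qed.

Let normSZ (a : S) x : normS (a *: x) = `|a| * normS x.
Proof. by rewrite /normS completion_normZ realSM realS_rnorm. Qed.

Let normS0_eq0 x : normS x = 0 -> x = 0.
Proof.
rewrite -(realS0 R k) => /(congr1 (@reS R k)); rewrite !realSK.
exact: completion_norm0_eq0.
Qed.

HB.instance Definition _ :=
  Lmodule_isNormed.Build S completion normSD normSZ normS0_eq0.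

Lemma rnorm_completion x : rnorm x = completion_norm x.
Proof. by rewrite /rnorm [X in reS X]/(normS x) realSK. Qed.

Fact is_cauchy_cst (v : V) : (fun=> v) \in is_cauchy.
Proof.
by apply/asboolP => e e0; exists 0%N => m n _ _; rewrite subrr seminorm0.
Qed.

Definition to_completion (v : V) : completion :=
  \pi_completion (CauchySequence (is_cauchy_cst v)).

Fact to_completion_linear : linear to_completion.
Proof.
move=> a u v; rewrite /to_completion -pi_completionZ -pi_completionD.
by congr (\pi_completion _); exact: val_inj.
Qed.

HB.instance Definition _ :=
  GRing.isLinear.Build S V completion *:%R to_completion to_completion_linear.

Lemma rnorm_to_completion v : rnorm (to_completion v) = p v.
Proof.
rewrite rnorm_completion completion_norm_pi.
apply/cvg_lim => //; rewrite [X in X @ _](_ : _ = cst (p v))//; exact: cvg_cst.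
Qed.

Lemma cauchy_sequence_approx (u : cauchy_sequence) (e : R) : 0 < e ->
  exists N, forall n, (N <= n)%N ->
    rnorm ((\pi_completion u : completion) - to_completion (u n)) < e.
Proof.
move=> e0; have e20 : 0 < e / 2 by rewrite divr_gt0.
have [N uN] := cauchy_sequenceP u e20; exists N => n Nn.
rewrite -pi_completionN -pi_completionD.
rewrite rnorm_completion completion_norm_pi.
apply: (@le_lt_trans _ _ (e / 2)); last by rewrite ltr_pdivrMr// ltr_pMr// ltr1n.
apply: limr_le; first exact: (cvg_cauchy_sequence
  (u - CauchySequence (is_cauchy_cst (u n)))).
by exists N => // m /= Nm; rewrite ltW// uN.
Qed.

Lemma to_completion_dense (x : completion) (e : R) : 0 < e ->
  exists v, rnorm (x - to_completion v) < e.
Proof.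
move=> /(cauchy_sequence_approx (repr x))[N /(_ N (leqnn _))].
by rewrite reprK; exists (repr x N).
Qed.

Let ltr_rnorm (x : completion) (e : R) :
  (`|x| < realS R k e) = (rnorm x < e).
Proof. by rewrite -realS_rnorm ltr_realS. Qed.

Lemma completion_complete (F : set_system completion) :
  ProperFilter F -> cauchy F -> cvg F.
Proof.
move=> FF /cauchyP FC.
have d_gt0 n : 0 < n.+1%:R^-1 :> R by rewrite invr_gt0.
have [x Fx] : {x : nat -> completion &
    forall n, F (ball (x n) (realS R k n.+1%:R^-1))}.
  apply: (@choice _ _ (fun n y => F (ball y (realS R k n.+1%:R^-1)))) => n.
  by apply: FC; rewrite -(realS0 R k) ltr_realS.
have [v xv] : {v : nat -> V &
    forall n, rnorm (x n - to_completion (v n)) < n.+1%:R^-1}.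
  apply: (@choice _ _ (fun n w => rnorm (x n - to_completion w) < n.+1%:R^-1)).
  by move=> n; exact: to_completion_dense.
have vF n y : ball (x n) (realS R k n.+1%:R^-1) y ->
    rnorm (to_completion (v n) - y) < n.+1%:R^-1 *+ 2.
  rewrite -ball_normE /ball_ /= ltr_rnorm => xy.
  rewrite -(subrK (x n) (to_completion _)) -addrA (le_lt_trans (rnormD _ _))//.
  by rewrite mulr2n ltrD// /rnorm distrC; exact: xv.
have inv_lt (e : R) : 0 < e -> exists N, forall n, (N <= n)%N ->
    n.+1%:R^-1 *+ 2 < e / 2.
  move=> e0; have e40 : 0 < e / 4 by rewrite divr_gt0.
  have [N _ NP] := near_infty_natSinv_lt (PosNum e40).
  exists N => n /NP /= ne; rewrite -[X in X < _]mulr_natr -ltr_pdivlMr//.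
  by rewrite (lt_le_trans ne)// -mulrA -invfM -natrM.
have vC : v \in is_cauchy.
  apply/asboolP => e /inv_lt[N NP]; exists N => m n Nm Nn.
  rewrite -rnorm_to_completion linearB/=.
  have [y [ym yn]] := filter_ex (filterI (Fx m) (Fx n)).
  rewrite -(subrK y (to_completion (v m))) -addrA (le_lt_trans (rnormD _ _))//.
  rewrite [e]splitr ltrD//; first exact: lt_trans (vF _ _ ym) (NP _ Nm).
  by rewrite /rnorm distrC; exact: lt_trans (vF _ _ yn) (NP _ Nn).
pose u := CauchySequence vC; apply/cvg_ex; exists (\pi_completion u).
apply/cvgrPdist_lt => e e0; have er0 : 0 < reS e.
  by rewrite -(ltr_realS k) reSK ?realS0// ltW.
have [N NP] := inv_lt _ er0.
have [|M MP] := @cauchy_sequence_approx u (reS e / 2); first by rewrite divr_gt0.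
have := Fx (maxn N M); apply: filterS => y /vF vy.
rewrite -[e]reSK ?ltW// ltr_rnorm.
rewrite -(subrK (to_completion (v (maxn N M))) (\pi_completion u : completion)).
rewrite -addrA (le_lt_trans (rnormD _ _))// [reS e]splitr ltrD//.
  exact: (MP _ (leq_maxr _ _)).
exact: lt_trans vy (NP _ (leq_maxl _ _)).
Qed.

HB.instance Definition _ :=
  Uniform_isComplete.Build completion completion_complete.

End Completion.

(* The algebraic tensor product is realized as the space of functionals
   phi |-> \sum_i c_i * phi e_i on the scalar-valued multilinear forms phi; the
   elementary tensor of e is evaluation at e. Over a field, scalar-valued forms
   separate points, so that this space has the universal property. *)
Section TensorProduct.
Variables (R : realType) (k : scalar_kind).
Local Notation S := (scalars R k).
Variables (J : finType) (E : J -> completeNormedModType S).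

Record multilinear_form := MultilinearForm {
  multilinear_fun :> (forall j, E j) -> S;
  multilinearP : forall (e : forall j, E j) (j : J) (a : S) (x y : E j),
    multilinear_fun (dfwith e j (a *: x + y)) =
      a * multilinear_fun (dfwith e j x) + multilinear_fun (dfwith e j y) }.

Definition is_tensor : {pred multilinear_form -> S^o} := fun u =>
  `[< exists s : seq (S * (forall j, E j)),
        u = (fun phi => \sum_(ce <- s) ce.1 * phi ce.2) >].

Fact is_tensor_submod : submod_closed is_tensor.
Proof.
split=> [|a u v /asboolP[s us] /asboolP[t vt]]; apply/asboolP.
  by exists [::]; apply/funext => phi; rewrite big_nil.
exists ([seq (a * ce.1, ce.2) | ce <- s] ++ t); apply/funext => phi.
rewrite !fctE us vt big_cat big_map /=; congr (_ + _).
by rewrite /GRing.scale/= mulr_sumr; apply: eq_bigr => ce _; rewrite mulrA.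
Qed.

HB.instance Definition _ :=
  GRing.isSubmodClosed.Build S (multilinear_form -> S^o) is_tensor is_tensor_submod.

Record tensor := Tensor {
  tensor_fun :> multilinear_form -> S^o;
  _ : tensor_fun \in is_tensor }.

HB.instance Definition _ := [isSub for tensor_fun].
HB.instance Definition _ := [Choice of tensor by <:].
HB.instance Definition _ := [SubChoice_isSubLmodule of tensor by <:].

Fact is_tensor_elementary (e : forall j, E j) :
  (fun phi : multilinear_form => phi e : S^o) \in is_tensor.
Proof.
by apply/asboolP; exists [:: (1, e)]; apply/funext => phi; rewrite big_seq1 mul1r.
Qed.

Definition elementary (e : forall j, E j) : tensor :=
  Tensor (is_tensor_elementary e).

Lemma tensorD_fun (u v : tensor) phi : (u + v) phi = u phi + v phi.
Proof. by []. Qed.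

Lemma tensorZ_fun a (u : tensor) phi : (a *: u) phi = a * u phi.
Proof. by []. Qed.

Lemma tensor_sum_fun I (r : seq I) (F : I -> tensor) phi :
  (\sum_(i <- r) F i) phi = \sum_(i <- r) F i phi.
Proof.
elim: r => [|i r ih]; first by rewrite !big_nil.
by rewrite !big_cons tensorD_fun ih.
Qed.

Lemma tensorE (u : tensor) : exists s : seq (S * (forall j, E j)),
  u = \sum_(ce <- s) ce.1 *: elementary ce.2.
Proof.
have /asboolP[s us] := valP u; exists s; apply/val_inj/funext => phi.
by rewrite [LHS](congr1 (@^~ phi) us) [RHS]tensor_sum_fun.
Qed.

Lemma elementaryP (e : forall j, E j) (j : J) (a : S) (x y : E j) :
  elementary (dfwith e j (a *: x + y)) =
    a *: elementary (dfwith e j x) + elementary (dfwith e j y).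
Proof. by apply/val_inj/funext => phi; exact: multilinearP. Qed.

Fact card_neq0 (j : J) : #|J| != 0%N.
Proof. by rewrite -lt0n; apply/card_gt0P; exists j. Qed.

Fact const_form_subproof (e : forall j, E j) (j : J) (a : S) (x y : E j) :
  (#|J| == 0)%N%:R = a * (#|J| == 0)%N%:R + (#|J| == 0)%N%:R :> S.
Proof.
by rewrite (negPf (card_neq0 j)) mulr0 addr0.
Qed.

(* Nonzero only for the empty family, whose tensor product is the field. *)
Definition const_form : multilinear_form :=
  @MultilinearForm (fun=> (#|J| == 0)%N%:R) const_form_subproof.

Definition weight (s : seq (forall j, E j)) : R :=
  \sum_(e <- s) \prod_(j : J) rnorm (e j).

(* A sum of elementary tensors has no room for scalars when the family is empty:
   the tensor product is then the field, normed by the absolute value. *)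
Definition proj_norm (u : tensor) : R :=
  if #|J| == 0%N then rnorm (u const_form : S)
  else inf [set weight s | s in [set s | u = \sum_(e <- s) elementary e]].

Lemma weight_ge0 s : 0 <= weight s.
Proof. by apply: sumr_ge0 => e _; apply: prodr_ge0 => j _; exact: rnorm_ge0. Qed.

Let scale_slot (e : forall j, E j) (j : J) (a : S) : forall j, E j :=
  dfwith e j (a *: e j).

Lemma elementaryZ (e : forall j, E j) (j : J) (a : S) :
  elementary (dfwith e j (a *: e j)) = a *: elementary e.
Proof.
have dfwith_id : dfwith e j (e j) = e.
  by apply: functional_extensionality_dep => i; case: dfwithP.
have dfwith0 : elementary (dfwith e j 0) = 0.
  have := elementaryP e (-1) (e j) (e j).
  by rewrite scaleN1r addNr scaleN1r addNr.
by have := elementaryP e a (e j) 0; rewrite addr0 dfwith0 addr0 dfwith_id.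
Qed.

Lemma prod_rnormZ (e : forall j, E j) (j : J) (a : S) :
  \prod_i rnorm (dfwith e j (a *: e j) i) = rnorm a * \prod_i rnorm (e i).
Proof.
rewrite (bigD1 j)//= [in RHS](bigD1 j)//= dfwithin rnormZ mulrA; congr (_ * _).
by apply: eq_bigr => i ij; rewrite dfwithout// eq_sym.
Qed.

Lemma elementary_span (u : tensor) : #|J| != 0%N ->
  exists s, u = \sum_(e <- s) elementary e.
Proof.
rewrite -lt0n => /card_gt0P[j _]; have [s ->] := tensorE u.
exists [seq scale_slot ce.2 j ce.1 | ce <- s].
by rewrite big_map; apply: eq_bigr => ce _; rewrite elementaryZ.
Qed.

Let weights u := [set weight s | s in [set s | u = \sum_(e <- s) elementary e]].

Let weights_inf u : #|J| != 0%N -> has_inf (weights u).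
Proof.
move=> J0; split; last by exists 0 => _ [s _ <-]; exact: weight_ge0.
by have [s us] := elementary_span u J0; exists (weight s), s.
Qed.

Lemma proj_norm_le u s : #|J| != 0%N -> u = \sum_(e <- s) elementary e ->
  proj_norm u <= weight s.
Proof.
move=> J0 us; rewrite /proj_norm (negPf J0); apply: ge_inf; last by exists s.
exact: (weights_inf u J0).2.
Qed.

Lemma le_proj_norm u r : #|J| != 0%N ->
  (forall s, u = \sum_(e <- s) elementary e -> r <= weight s) ->
  r <= proj_norm u.
Proof.
move=> J0 ur; rewrite /proj_norm (negPf J0); apply: lb_le_inf.
  exact: (weights_inf u J0).1.
by move=> _ [s us <-]; exact: ur.
Qed.

Lemma proj_normD u v : proj_norm (u + v) <= proj_norm u + proj_norm v.
Proof.
have [J0|J0] := eqVneq #|J| 0%N.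
  by rewrite /proj_norm J0 eqxx tensorD_fun rnormD.
rewrite -lerBlDl; apply: le_proj_norm => // t vt.
rewrite lerBlDl -lerBlDr; apply: le_proj_norm => // s us.
rewrite lerBlDr (@le_trans _ _ (weight (s ++ t)))//; last first.
  by rewrite /weight big_cat.
by apply: proj_norm_le => //; rewrite big_cat us vt.
Qed.

Let proj_normZ_le (a : S) u : #|J| != 0%N ->
  proj_norm (a *: u) <= rnorm a * proj_norm u.
Proof.
move=> J0; have [->|a0] := eqVneq a 0.
  rewrite rnorm0 mul0r scale0r.
  apply: le_trans (proj_norm_le (s := [::]) J0 _) _; first by rewrite big_nil.
  by rewrite /weight big_nil.
have ra0 : 0 < rnorm a.
  rewrite lt_neqAle rnorm_ge0 andbT eq_sym; apply: contra_neq a0.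
  exact: rnorm0_eq0.
rewrite mulrC -ler_pdivrMr//; apply: le_proj_norm => // s us.
rewrite ler_pdivrMr// mulrC.
have /card_gt0P[j _] : (0 < #|J|)%N by rewrite lt0n.
pose t := [seq scale_slot e j a | e <- s].
rewrite (@le_trans _ _ (weight t))//.
  apply: proj_norm_le => //; rewrite us scaler_sumr big_map.
  by apply: eq_bigr => e _; rewrite elementaryZ.
by rewrite /weight mulr_sumr big_map; under eq_bigr do rewrite prod_rnormZ.
Qed.

Lemma proj_normZ (a : S) u : proj_norm (a *: u) = rnorm a * proj_norm u.
Proof.
have [J0|J0] := eqVneq #|J| 0%N.
  by rewrite /proj_norm J0 eqxx tensorZ_fun rnormM.
apply/eqP; rewrite eq_le proj_normZ_le//=.
have [->|a0] := eqVneq a 0.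
  rewrite rnorm0 mul0r; apply: le_proj_norm => // s _; exact: weight_ge0.
have ra0 : 0 < rnorm a.
  rewrite lt_neqAle rnorm_ge0 andbT eq_sym; apply: contra_neq a0.
  exact: rnorm0_eq0.
rewrite -{1}[u](scalerK a0) mulrC -ler_pdivlMr//.
rewrite (le_trans (proj_normZ_le _ _ J0))// mulrC ler_pdivlMr//.
by rewrite -mulrA -rnormM mulVf// rnorm1 mulr1.
Qed.

Definition proj_seminorm : seminorm tensor := Seminorm proj_normD proj_normZ.

Definition proj_tensor : completeNormedModType S := completion proj_seminorm.

Definition proj_elementary (e : forall j, E j) : proj_tensor :=
  to_completion proj_seminorm (elementary e).

Lemma dual_proj_tensor_eq (nu nu' : dual proj_tensor) :
  (forall e, nu (proj_elementary e) = nu' (proj_elementary e)) -> nu = nu'.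
Proof.
move=> eq_nu; apply/eqP; rewrite -subr_eq0; apply/eqP.
set d := nu - nu'.
have de e : d (proj_elementary e) = 0.
  by apply/eqP; rewrite [d _]/(nu _ - nu' _) subr_eq0 eq_nu.
clearbody d.
have d0 u : d (to_completion proj_seminorm u) = 0.
  have [s ->] := tensorE u; rewrite !linear_sum big1// => ce _.
  by rewrite 2!linearZ -[RHS](scaler0 _ ce.1); congr (_ *: _); exact: de.
apply/val_inj/funext => x; apply: rnorm0_eq0; apply/eqP.
rewrite eq_le rnorm_ge0 andbT; apply/ler_addgt0Pr => e e0; rewrite add0r.
have D0 : 0 < op_norm d + 1 by rewrite ltr_wpDl ?op_norm_ge0.
have [|u xu] := @to_completion_dense _ _ _ proj_seminorm x (e / (op_norm d + 1)).
  by rewrite divr_gt0.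
have -> : \val d x = d (x - to_completion proj_seminorm u).
  by rewrite linearB [X in _ - X](d0 u) subr0.
rewrite (le_trans (op_norm_le _ _))//.
rewrite (le_trans (ler_wpM2l (op_norm_ge0 _) (ltW xu)))//.
by rewrite mulrCA ler_piMr ?ltW// ltr_pdivrMr// mul1r ltrDl.
Qed.

End TensorProduct.

Definition grothendieck_bound (R : realType) (k : scalar_kind) (C : R) : Prop :=
  forall (m : nat) (a : 'M[scalars R k]_m), (1 <= m)%N ->
  (forall s t : 'I_m -> scalars R k,
     (forall i, rnorm (s i) <= 1) -> (forall j, rnorm (t j) <= 1) ->
     rnorm (\sum_i \sum_j a i j * s i * t j) <= 1) ->
  forall (H : completeNormedModType (scalars R k)) (ip : {dot H for @conjS R k}),
  (forall x, ip x x = `|x| ^+ 2) ->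
  forall x y : 'I_m -> H,
    (forall i, rnorm (x i) <= 1) -> (forall j, rnorm (y j) <= 1) ->
    rnorm (\sum_i \sum_j a i j * ip (x i) (y j)) <= C.

(* The set of bounds is closed and, by Grothendieck's inequality, nonempty, so
   that its infimum is its least element. *)
Definition grothendieck_constant (R : realType) (k : scalar_kind) : R :=
  inf [set C | @grothendieck_bound R k C].

Definition multiple_grothendieck_integral (R : realType) (k : scalar_kind)
    (n : nat) (E : 'I_n -> completeNormedModType (scalars R k))
    (mu : {scalar tensor E}) : Prop :=
  exists2 C : R, C <= grothendieck_constant R k ^+ n.-1 &
    forall u, rnorm (mu u) <= C * proj_norm u.

Definition remaining (I : finType) (s : seq I) : finType :=
  {i : I | i \notin s}.

Definition others (R : realType) (k : scalar_kind) (I : finType)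
    (E : I -> completeNormedModType (scalars R k)) (s : seq I)
    (i : remaining s) : completeNormedModType (scalars R k) := E (sval i).

Arguments others {R k I} E s i.

Section PartialIntegration.
Variables (R : realType) (k : scalar_kind).
Local Notation S := (scalars R k).
Variables (I : finType) (E : I -> completeNormedModType S).

(* The default 0 is never read: an index outside [s] is [j] or outside [j :: s]. *)
Definition insert_vector (s : seq I) (j : I) (x : E j)
    (f : forall i : remaining (j :: s), others E (j :: s) i) (i : remaining s) :
    others E s i :=
  dfwith (fun i0 : I => match boolP (i0 \notin j :: s) return E i0 with
                        | AltTrue h => f (exist _ i0 h)
                        | AltFalse _ => 0
                        end) j x (sval i).

(* [nu'] is obtained from [nu] by fixing [x] in the slot [j]; there is at most
   one such functional, see [dual_proj_tensor_eq]. *)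
Definition fixes_vector (s : seq I) (j : I)
    (nu : dual (proj_tensor (others E s))) (x : E j)
    (nu' : dual (proj_tensor (others E (j :: s)))) : Prop :=
  forall f, nu' (proj_elementary f) = nu (proj_elementary (insert_vector x f)).

(* [nu] is a functional on the product of the spaces not listed in [s]; the
   vectors indexed by [t] are fixed one after the other, and [c] is the value
   obtained. When no space is left, the final functional is evaluated at the
   only elementary tensor of the empty family. *)
Fixpoint integrates_to (s t : seq I) (nu : dual (proj_tensor (others E s)))
    (e : forall i, E i) (c : S) : Prop :=
  match t with
  | [::] => c = nu (proj_elementary (E := others E s) (fun i => e (sval i)))
  | j :: t' => exists2 nu', fixes_vector nu (e j) nu' & integrates_to t' nu' e c
  end.

Definition iterated_integral
    (T : forall i, bounded_op (E i) (dual (proj_tensor (others E [:: i]))))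
    (e : forall i, E i) (s : seq I) (c : S) : Prop :=
  match s with
  | [::] => False
  | i :: t => integrates_to t (T i (e i)) e c
  end.

Lemma integrates_to_unique (s t : seq I)
    (nu : dual (proj_tensor (others E s))) (e : forall i, E i) (c c' : S) :
  integrates_to t nu e c -> integrates_to t nu e c' -> c = c'.
Proof.
elim: t s nu => [s nu -> -> //|j t ih s nu] [nu1 f1 i1] [nu2 f2 i2].
have eq12 : nu1 = nu2 by apply: dual_proj_tensor_eq => f; rewrite f1 f2.
by move: i1; rewrite eq12 => i1; exact: ih i1 i2.
Qed.

Lemma iterated_integral_unique
    (T : forall i, bounded_op (E i) (dual (proj_tensor (others E [:: i]))))
    (e : forall i, E i) (s : seq I) (c c' : S) :
  iterated_integral T e s c -> iterated_integral T e s c' -> c = c'.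
Proof. by case: s => //= i t; exact: integrates_to_unique. Qed.

End PartialIntegration.

(* Main.v *)
From HB Require Import structures.
Require Import Defs.
From mathcomp Require Import all_boot all_order all_algebra all_fingroup.
From mathcomp Require Import complex.
From mathcomp Require Import all_classical all_reals all_analysis.
Import Order.TTheory GRing.Theory Num.Theory.
Import numFieldNormedType.Exports.
Local Open Scope ring_scope.

(* On algebraic tensors, [u |-> mu (u with the vectors e_i, i in s, inserted)] is
   the linearization of a multilinear form bounded by [K * \prod_(i in s) |e_i|],
   where [K] is the (n-1)st power of Grothendieck's constant; being bounded for the
   projective norm, it extends to the completion because the scalars are complete.
   For [s = [:: i]] these functionals define the operator [T i], and for longer [s]
   they are the successive partial integrals: inserting one more vector turns the
   functional for [s] into the one for [j :: s], and once every vector has been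
   inserted the functional takes the value [mu (e_1 (x) ... (x) e_n)]. *)

(** * Completeness of the real and complex scalars *)

Lemma le_small_eq0 {R : realFieldType} (x M : R) : 0 <= x ->
  (forall e, 0 < e -> x <= M * e) -> x = 0.
Proof.
move=> x0 xM; apply/eqP; rewrite eq_le x0 andbT; apply/ler_addgt0Pr => e e0.
rewrite add0r.
have M0 : 0 < `|M| + 1 by rewrite ltr_wpDl.
have := xM (e / (`|M| + 1)); rewrite divr_gt0// => /(_ isT)/le_trans; apply.
rewrite mulrCA ler_piMr ?(ltW e0)// ler_pdivrMr// mul1r.
by rewrite (le_trans (ler_norm M))// lerDl.
Qed.

Lemma cauchy_real {R : realType} (u : nat -> R) :
  (forall e, 0 < e -> exists N, forall m n,
     (N <= m)%N -> (N <= n)%N -> `|u m - u n| < e) ->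
  exists l, forall e, 0 < e -> exists N, forall n, (N <= n)%N -> `|u n - l| < e.
Proof.
move=> uC.
have uF : cauchy (u @ \oo)%classic.
  apply/cauchy_exP => e e0; have [N uN] := uC e e0.
  by exists (u N); exists N => // n /= Nn; exact: uN.
have /cvg_ex[l /cvgrPdist_lt ul] : cvg (u @ \oo)%classic by exact: R_complete.
exists l => e /ul[N _ uN]; exists N => n Nn.
by rewrite distrC; exact: uN.
Qed.

(** In the complex case the modulus dominates the real and imaginary parts, which are thus Cauchy,
    and is at most the sum of their absolute values, so their limits recombine. *)
Lemma cauchy_scalars {R : realType} {k : scalar_kind} (u : nat -> scalars R k) :
  (forall e, 0 < e -> exists N, forall m n,
     (N <= m)%N -> (N <= n)%N -> rnorm (u m - u n) < e) ->
  exists l : scalars R k, forall e, 0 < e ->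
    exists N, forall n, (N <= n)%N -> rnorm (u n - l) < e.
Proof.
case: k u => /= u uC; first exact: cauchy_real.
have rnormE (z : R[i]%C) : @rnorm R ComplexScalars R[i]%C z = complex.Re `|z| by [].
have re_le (z : R[i]%C) : `|complex.Re z| <= @rnorm R ComplexScalars R[i]%C z.
  by rewrite rnormE -lecR; exact: normc_ge_Re.
have im_le (z : R[i]%C) : `|complex.Im z| <= @rnorm R ComplexScalars R[i]%C z.
  case: z => x y; rewrite rnormE normc_def /= -sqrtr_sqr ler_sqrt ?addr_ge0 ?sqr_ge0//.
  by rewrite lerDr sqr_ge0.
have le_reim (z : R[i]%C) :
    @rnorm R ComplexScalars R[i]%C z <= `|complex.Re z| + `|complex.Im z|.
  case: z => x y; rewrite rnormE normc_def /= -[leRHS]ger0_norm ?addr_ge0//.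
  rewrite -sqrtr_sqr ler_sqrt ?sqr_ge0// sqrrD !real_normK ?num_real//.
  by rewrite addrAC lerDl mulrn_wge0// mulr_ge0.
have [|x ux] := cauchy_real (fun n => complex.Re (u n)).
  move=> e /uC[N uN]; exists N => m n Nm Nn.
  by apply: le_lt_trans (uN _ _ Nm Nn); rewrite -raddfB; exact: re_le.
have [|y uy] := cauchy_real (fun n => complex.Im (u n)).
  move=> e /uC[N uN]; exists N => m n Nm Nn.
  by apply: le_lt_trans (uN _ _ Nm Nn); rewrite -raddfB; exact: im_le.
exists (x +i* y)%C => e e0; have e20 : 0 < e / 2 by rewrite divr_gt0.
have [[N uN] [M uM]] := (ux _ e20, uy _ e20).
exists (maxn N M) => n; rewrite geq_max => /andP[/uN Nn /uM Mn].
by rewrite (le_lt_trans (le_reim _))// [e]splitr !raddfB ltrD.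
Qed.

Lemma rnormB {R : realType} {k : scalar_kind}
  {W : normedZmodType (scalars R k)} (x y : W) : rnorm (x - y) = rnorm (y - x).
Proof. by rewrite /rnorm distrC. Qed.

Lemma rnorm_triangle {R : realType} {k : scalar_kind}
  {W : normedZmodType (scalars R k)} (y x z : W) :
  rnorm (x - z) <= rnorm (x - y) + rnorm (y - z).
Proof. by rewrite -[x - z](subrKA y) rnormD. Qed.

(** * Extension of a bounded functional to the completion *)

Section ExtensionToCompletion.
Context {R : realType} {k : scalar_kind}.
Local Notation S := (scalars R k).
Context {V : lmodType S} {p : seminorm V}.

Context (l : {scalar V}) (M : R).
Hypotheses (M0 : 0 <= M) (lM : forall v, rnorm (l v : S) <= M * p v).

(** Comparing with every [v] at once pins [y] down by density, with no reference to an approximating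
    sequence. *)
Let extends (x : completion p) (y : S) :=
  forall v, rnorm (y - l v) <= M * rnorm (x - to_completion p v).

Let extends_exists x : exists y, extends x y.
Proof.
have [v xv] : {v : nat -> V & forall n, rnorm (x - to_completion p (v n)) < n.+1%:R^-1}.
  apply: (@choice _ _ (fun n w => rnorm (x - to_completion p w) < n.+1%:R^-1)).
  by move=> n; apply: to_completion_dense; rewrite invr_gt0.
have lB w w' : rnorm (l w - l w') <=
    M * (rnorm (x - to_completion p w) + rnorm (x - to_completion p w')).
  rewrite -linearB (le_trans (lM _))// ler_wpM2l// -rnorm_to_completion linearB/=.
  by rewrite (le_trans (rnorm_triangle x _ _))// lerD2r rnormB.
have inv_lt (e : R) : 0 < e -> exists N, forall n, (N <= n)%N -> n.+1%:R^-1 < e.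
  by move=> e0; have [N _ NP] := near_infty_natSinv_lt (PosNum e0); exists N.
(* Tolerances are divided by [M + 1] because [M] may be 0. *)
have M1 : 0 < M + 1 by rewrite ltr_wpDl.
have lM_lt (e : R) : 0 < e -> M * (e / (M + 1)) < e.
  by move=> e0; rewrite mulrCA gtr_pMr// ltr_pdivrMr// mul1r ltrDl.
have [e e0|y ly] := cauchy_scalars (fun n => l (v n)).
  have [|N NP] := inv_lt (e / (M + 1) / 2); first by rewrite !divr_gt0.
  exists N => m n /NP Nm /NP Nn; rewrite (le_lt_trans (lB _ _))//.
  apply: le_lt_trans (lM_lt e e0); rewrite ler_wpM2l// [leRHS]splitr.
  by rewrite lerD// ltW// (lt_trans (xv _)).
exists y => w; apply/ler_addgt0Pr => e e0.
have e20 : 0 < e / 2 by rewrite divr_gt0.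
have [|N NP] := inv_lt (e / 2 / (M + 1)); first by rewrite !divr_gt0.
have [N' N'P] := ly _ e20.
(* Passing through [l (v n)] costs at most [e / 2] on the side of [y] and [e / 2] for [M] times the
   distance from [x] to [v n]. *)
set n := maxn N N'.
rewrite (le_trans (rnorm_triangle (l (v n)) _ _))//.
rewrite [e]splitr addrCA lerD//.
  by rewrite rnormB ltW// N'P// leq_maxr.
rewrite (le_trans (lB _ _))// mulrDr addrC lerD2r.
apply: le_trans (ltW (lM_lt _ e20)).
by rewrite ler_wpM2l// ltW// (lt_trans (xv _))// NP// leq_maxl.
Qed.

Let ext x : S := sval (cid (extends_exists x)).

Let extP x : extends x (ext x).
Proof. by rewrite /ext; case: cid. Qed.

(** For [v], [w] within [e] of [x], [y], both sides of the linearity equation lie within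
    [M * (rnorm a + 1) * e] of [l (a *: v + w)]. *)
Let ext_linear : linear (ext : completion p -> S^o).
Proof.
move=> a x y; apply/eqP; rewrite -subr_eq0; apply/eqP; apply: rnorm0_eq0.
apply: (@le_small_eq0 _ _ (M * (rnorm a + 1) *+ 2)); first exact: rnorm_ge0.
move=> e e0.
have [v /ltW xv] := to_completion_dense x e0.
have [w /ltW yw] := to_completion_dense y e0.
have approx : rnorm (a *: (x - to_completion p v) + (y - to_completion p w)) <=
    (rnorm a + 1) * e.
  rewrite (le_trans (rnormD _ _))// rnormZ mulrDl mul1r lerD//.
  by rewrite ler_wpM2l ?rnorm_ge0.
rewrite (le_trans (rnorm_triangle (l (a *: v + w) : S^o) _ _))//.
rewrite mulr2n mulrDl; apply: lerD; rewrite -mulrA.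
  rewrite (le_trans (extP _ _))// ler_wpM2l//; apply: le_trans approx.
  by rewrite linearP scalerBr opprD addrACA.
rewrite linearP opprD addrACA -scalerBr mulrDl mul1r mulrDr.
rewrite (le_trans (rnormD _ _))// rnormZ rnormB lerD//.
  rewrite mulrCA ler_wpM2l ?rnorm_ge0// (le_trans (extP _ _))//.
  by rewrite ler_wpM2l.
by rewrite rnormB (le_trans (extP _ _))// ler_wpM2l.
Qed.

Lemma extend_completion : exists2 nu : dual (completion p),
  forall v, nu (to_completion p v) = l v & op_norm nu <= M.
Proof.
(* This is [extends] at the vector 0; agreement with [l] is [extends] at distance 0. *)
have extM x : rnorm (ext x) <= M * rnorm x.
  by have := extP x 0; rewrite !linear0 !addr0.
have extB : (ext : completion p -> S^o) \in @bounded_linear R k (completion p) S^o.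
  by apply/asboolP; split; [exact: ext_linear|exists M].
exists (BoundedOp extB); last exact: op_norm_le_bound.
move=> v; apply/eqP; rewrite -subr_eq0; apply/eqP/rnorm0_eq0/eqP.
rewrite eq_le rnorm_ge0 andbT (le_trans (extP _ _))//.
by rewrite subrr rnorm0 mulr0.
Qed.

End ExtensionToCompletion.

(** * Functionals on the projective tensor product from bounded forms *)

Section ExtensionOfForms.
Context {R : realType} {k : scalar_kind}.
Local Notation S := (scalars R k).

(** The linearization of [phi] promised by the universal property, named so that it can carry a
    linear structure. *)
Definition tensor_eval {J : finType} {F : J -> completeNormedModType S}
  (phi : multilinear_form F) (u : tensor F) : S := u phi.

HB.instance Definition _ {J : finType} {F : J -> completeNormedModType S}
    (phi : multilinear_form F) :=
  GRing.isLinear.Build S (tensor F) S *%R (tensor_eval phi) (fun a u v => erefl).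

Lemma proj_norm_ge0 {J : finType} {F : J -> completeNormedModType S}
  (u : tensor F) : 0 <= proj_norm u.
Proof. exact: (@seminorm_ge0 _ _ _ (proj_seminorm F)). Qed.

Lemma proj_norm_elementary {J : finType} {F : J -> completeNormedModType S}
    (f : forall j, F j) : #|J| != 0 ->
  proj_norm (elementary f) <= \prod_j rnorm (f j).
Proof.
move=> J0; apply: (@le_trans _ _ (weight [:: f])); last by rewrite /weight big_seq1.
by apply: proj_norm_le => //; rewrite big_seq1.
Qed.

(** Each representation of [u] by elementary tensors bounds the linearization by [M] times its
    weight; the infimum gives [M * proj_norm u], and [extend_completion] applies. *)
Lemma extend_form {J : finType} {F : J -> completeNormedModType S}
    (phi : multilinear_form F) (M : R) : 0 <= M ->
  (forall f, rnorm (phi f) <= M * \prod_j rnorm (f j)) ->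
  exists2 nu : dual (proj_tensor F),
    forall f, nu (proj_elementary f) = phi f & op_norm nu <= M.
Proof.
move=> M0 phiM.
have phi_le (u : tensor F) : rnorm (tensor_eval phi u) <= M * proj_norm u.
  (* The empty family arises once every vector has been inserted. All its [f] coincide, so [u] is a
     multiple of one elementary tensor. *)
  have [J0|J0] := eqVneq #|J| 0.
    have [s us] := tensorE u.
    have big_J0 (T : Type) (idx : T) op (G : J -> T) : \big[op/idx]_j G j = idx.
      by apply: big_pred0 => j; have := card0_eq J0 j.
    have f_eq (f g : forall j, F j) : f = g.
      by apply: functional_extensionality_dep => j; have := card0_eq J0 j.
    rewrite /proj_norm J0 eqxx /tensor_eval us !tensor_sum_fun.
    case: s {us} => [|[c f] s]; first by rewrite !big_nil !rnorm0 mulr0.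
    under eq_bigr => ce _ do rewrite tensorZ_fun /= (f_eq ce.2 f).
    under [in leRHS]eq_bigr => ce _ do
      rewrite tensorZ_fun /= /const_form /= J0 eqxx mulr1.
    rewrite -mulr_suml rnormM mulrC ler_wpM2r ?rnorm_ge0//.
    by have := phiM f; rewrite big_J0 mulr1.
  (* [M = 0] is split off since reaching the infimum requires dividing by [M]. *)
  have [M_eq0|M_neq0] := eqVneq M 0.
    have [s ->] := elementary_span u J0.
    rewrite M_eq0 linear_sum mul0r big1 ?rnorm0// => f _; apply: rnorm0_eq0.
    by apply/eqP; rewrite eq_le rnorm_ge0 andbT; have := phiM f; rewrite M_eq0 mul0r.
  have M_gt0 : 0 < M by rewrite lt_neqAle eq_sym M_neq0.
  rewrite mulrC -ler_pdivrMr//; apply: le_proj_norm => // s ->.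
  rewrite ler_pdivrMr// linear_sum /weight mulrC mulr_sumr.
  elim/big_ind2: _ => [|x1 x2 y1 y2 xy1 xy2|f _]; first by rewrite rnorm0.
    by rewrite (le_trans (rnormD _ _))// lerD.
  exact: phiM.
have [nu nuE nuM] :=
  @extend_completion _ _ _ (proj_seminorm F) (tensor_eval phi) _ M0 phi_le.
by exists nu => // f; rewrite nuE.
Qed.

End ExtensionOfForms.

(** * Families with the slots in [s] filled in advance *)

Section Glue.
Context {R : realType} {k : scalar_kind}.
Local Notation S := (scalars R k).
Context {I : finType} {E : I -> completeNormedModType S}.

(** The match keeps the proof of [i \notin s], which [f] takes as part of its index, and has the
    shape used in [insert_vector]. *)
Definition glue (s : seq I) (e : forall i, E i) (f : forall i : remaining s, others E s i)
    (i : I) : E i :=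
  match boolP (i \notin s) return E i with
  | AltTrue h => f (exist _ i h)
  | AltFalse _ => e i
  end.

Lemma glue_notin s e f i (h : i \notin s) : glue s e f i = f (exist _ i h).
Proof.
refine (match boolP (i \notin s) as b return
  match b return E i with AltTrue h' => f (exist _ i h') | AltFalse _ => e i end =
  f (exist _ i h) with AltTrue h' => _ | AltFalse hN => _ end).
  by rewrite (bool_irrelevance h' h).
by have := hN; rewrite h.
Qed.

Lemma glue_in s e f i : i \in s -> glue s e f i = e i.
Proof.
move=> si; refine (match boolP (i \notin s) as b return
  match b return E i with AltTrue h' => f (exist _ i h') | AltFalse _ => e i end =
  e i with AltTrue h => _ | AltFalse _ => erefl end).
by have := h; rewrite si.
Qed.

(** Transfers multilinearity of [elementary] to the slots outside [s]. *)
Lemma glue_dfwith s e f (j : remaining s) (x : others E s j) :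
  glue s e (dfwith f j x) = dfwith (glue s e f) (sval j) x.
Proof.
apply: functional_extensionality_dep => i; case: (boolP (i \notin s)) => [h|h].
  rewrite !glue_notin; case: j x => j jh x /=.
  have [ij|ij] := eqVneq j i.
    subst i; rewrite (bool_irrelevance h jh) dfwithin.
    by rewrite [RHS]dfwithin.
  rewrite dfwithout ?[RHS]dfwithout ?glue_notin//.
have := h; rewrite negbK => is_.
rewrite dfwithout ?glue_in//; apply: contraNneq h => <-; exact: (svalP j).
Qed.

Lemma glue_id s e : glue s e (fun i => e (sval i)) = e.
Proof.
by apply: functional_extensionality_dep => i; have [h|] := boolP (i \notin s);
  [rewrite glue_notin|rewrite negbK => /glue_in].
Qed.

(** One step of partial integration at the level of families: slot [j] passes from the remaining
    ones to the fixed ones. *)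
Lemma glue_insert s e j f :
  glue s e (insert_vector (e j) f) = glue (j :: s) e f.
Proof.
apply: functional_extensionality_dep => i.
case: (boolP (i \notin s)) => h; last first.
  have is_ : i \in s by rewrite -[_ \in _]negbK.
  by rewrite !glue_in// inE is_ orbT.
rewrite (glue_notin s _ _ _ h) /insert_vector /=.
have [ij|ij] := eqVneq j i.
  by subst i; rewrite dfwithin glue_in ?mem_head.
have h' : i \notin j :: s by rewrite inE negb_or eq_sym ij.
(* The default family inside [insert_vector] is, by conversion, a [glue] with zeros in the fixed
   slots. *)
rewrite dfwithout// [LHS](_ : _ = glue (j :: s) (fun=> 0) f i)//.
by rewrite !glue_notin.
Qed.

Lemma prod_glue s e f :
  \prod_i rnorm (glue s e f i) =
  \prod_(i in s) rnorm (e i) * \prod_(i : remaining s) rnorm (f i).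
Proof.
rewrite (bigID [in s])/=; congr (_ * _).
  by apply: eq_bigr => i si; rewrite glue_in.
rewrite (big_sub [pred i | i \notin s])/=.
by apply: eq_bigr => -[i h] _ /=; rewrite glue_notin.
Qed.

(** * Partial integrals of [mu] and the operators they define *)

Context (mu : {scalar tensor E}).

Fact glue_form_subproof s e (f : forall j : remaining s, others E s j) j a x y :
  mu (elementary (glue s e (dfwith f j (a *: x + y)))) =
  a * mu (elementary (glue s e (dfwith f j x))) +
    mu (elementary (glue s e (dfwith f j y))).
Proof. by rewrite !glue_dfwith elementaryP linearP. Qed.

Definition glue_form s e : multilinear_form (others E s) :=
  @MultilinearForm _ _ _ (others E s) (fun f => mu (elementary (glue s e f)))
    (glue_form_subproof s e).

Context {K : R}.
Hypotheses (K0 : 0 <= K) (I0 : #|I| != 0)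
  (muK : forall u, rnorm (mu u) <= K * proj_norm u).

(** The projective norm of the glued elementary tensor is at most a product of norms; its factors
    over [s] go into the bound of the form. *)
Lemma fix_vectors s e : exists2 nu : dual (proj_tensor (others E s)),
  forall f, nu (proj_elementary f) = mu (elementary (glue s e f)) &
  op_norm nu <= K * \prod_(i in s) rnorm (e i).
Proof.
apply: (extend_form (glue_form s e)) => [|f].
  by rewrite mulr_ge0// prodr_ge0// => i _; exact: rnorm_ge0.
rewrite (le_trans (muK _))// -mulrA ler_wpM2l// -prod_glue.
exact: proj_norm_elementary.
Qed.

(** Induction on [t] with [s] general: the formula for [nu] on elementary tensors is the invariant,
    and [glue_insert] preserves it. *)
Lemma integrates_to_glue t s (nu : dual (proj_tensor (others E s))) e :
  (forall f, nu (proj_elementary f) = mu (elementary (glue s e f))) ->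
  integrates_to t nu e (mu (elementary e)).
Proof.
elim: t s nu => [|j t IHt] s nu nuE /=; first by rewrite nuE glue_id.
have [nu' nu'E _] := fix_vectors (j :: s) e.
exists nu'; last exact: IHt.
by move=> f; rewrite nuE nu'E glue_insert.
Qed.

(** Isolates the dependence on [e i] in a single [dfwith], where [elementaryP] gives linearity. *)
Lemma glue1 i e f : glue [:: i] e f = dfwith (glue [:: i] (fun=> 0) f) i (e i).
Proof.
apply: functional_extensionality_dep => j; have [<-|ij] := eqVneq i j.
  by rewrite dfwithin glue_in ?mem_head.
have h : j \notin [:: i] by rewrite inE eq_sym.
by rewrite dfwithout// !glue_notin.
Qed.

(** A functional is chosen for each [x]; linearity in [x] follows because functionals are determined
    by elementary tensors, where it is multilinearity in slot [i]. *)
Lemma partial_integration_op (i : I) :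
  exists2 T : bounded_op (E i) (dual (proj_tensor (others E [:: i]))),
    forall e f, T (e i) (proj_elementary f) = mu (elementary (glue [:: i] e f)) &
    op_norm T <= K.
Proof.
(* The zeros are placeholders: gluing along [[:: i]] reads only slot [i]. *)
pose single x : forall j, E j := dfwith (fun=> 0) i x.
have [T0 T0P] : {T0 : E i -> dual (proj_tensor (others E [:: i])) & forall x,
    (forall f, T0 x (proj_elementary f) =
       mu (elementary (glue [:: i] (single x) f))) /\ rnorm (T0 x) <= K * rnorm x}.
  apply: (@choice _ _ (fun x (nu : dual (proj_tensor (others E [:: i]))) =>
    (forall f, nu (proj_elementary f) =
       mu (elementary (glue [:: i] (single x) f))) /\ rnorm nu <= K * rnorm x)) => x.
  have [nu nuE nuK] := fix_vectors [:: i] (single x); exists nu; split=> //.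
  rewrite rnorm_bounded_op (le_trans nuK)// (big_pred1 i); last first.
    by move=> j; rewrite inE.
  by rewrite /single dfwithin.
have T0E x := (T0P x).1; have T0K x := (T0P x).2.
have T0_linear : linear T0.
  move=> a x y; apply: dual_proj_tensor_eq => f.
  rewrite [RHS]/(a * T0 x (proj_elementary f) + T0 y (proj_elementary f)).
  rewrite !T0E !(glue1 _ (single _)) /single !dfwithin.
  by rewrite elementaryP linearP.
have T0B : T0 \in @bounded_linear R k (E i) (dual (proj_tensor (others E [:: i]))).
  by apply/asboolP; split=> //; exists K.
exists (BoundedOp T0B); last exact: op_norm_le_bound.
move=> e f /=; rewrite T0E; congr (mu (elementary _)).
by rewrite glue1 [RHS]glue1 /single dfwithin.
Qed.

End Glue.

(* A negative bound could only be vacuous, so that every real would be a bound and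
   the infimum would take its junk value 0: no Hilbert space has to be exhibited. *)
Lemma grothendieck_constant_ge0 (R : realType) (k : scalar_kind) :
  0 <= grothendieck_constant R k.
Proof.
rewrite /grothendieck_constant; set B := [set C | _]%classic.
have [B0|] := pselect (lbound B 0).
  have [[C BC]|B_empty] := pselect (exists C, B C).
    by apply: lb_le_inf => //; exists C.
  by rewrite inf_out// => -[].
move=> negB; rewrite inf_out// => -[_ [b bB]]; apply: negB => C BC.
rewrite leNgt; apply/negP => C0.
have BT C' : B C'.
  move=> m a m1 aP H ip ipE x y xP yP.
  have := BC m a m1 aP H ip ipE x y xP yP.
  by move=> /(le_trans (rnorm_ge0 _)); rewrite leNgt C0.
by have := bB _ (BT (b - 1)); rewrite lerBrDr gerDl ler10.
Qed.

Theorem theorem5p3 (R : realType) (k : scalar_kind) (n : nat) (hn : (2 <= n)%N)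
    (E : 'I_n -> completeNormedModType (scalars R k))
    (mu : {scalar tensor E}) (phi : (forall i, E i) -> scalars R k) :
  multiple_grothendieck_integral mu ->
  (forall e, phi e = mu (elementary e)) ->
  exists T : forall i, bounded_op (E i) (dual (proj_tensor (others E [:: i]))),
    (forall i,
       (forall (e : forall j, E j),
          T i (e i) (proj_elementary (E := others E [:: i])
                       (fun j => e (sval j))) = phi e) /\
       rnorm (T i) <= grothendieck_constant R k ^+ n.-1) /\
    (forall (sigma : 'S_n) (e : forall j, E j),
       iterated_integral T e [seq sigma i | i <- enum 'I_n]
         (mu (elementary e))).
Proof.
move=> [C CK muC] phiE; set K := grothendieck_constant R k ^+ n.-1.
have K0 : 0 <= K by rewrite exprn_ge0// grothendieck_constant_ge0.
have I0 : #|'I_n| != 0 by rewrite card_ord -lt0n (leq_trans _ hn).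
have muK u : rnorm (mu u) <= K * proj_norm u.
  by rewrite (le_trans (muC u))// ler_wpM2r// proj_norm_ge0.
have TE i := cid2 (partial_integration_op mu K0 I0 muK i).
pose T i := s2val (TE i); exists T; split.
  move=> i; split; last by rewrite rnorm_bounded_op; exact: (s2valP' (TE i)).
  by move=> e; rewrite (s2valP (TE i)) glue_id phiE.
(* A nonempty order has a first index [i], and [T i (e i)] starts the induction with [s =
   [:: i]]. *)
move=> sigma e; have : [seq sigma i | i <- enum 'I_n] != [::].
  by rewrite -size_eq0 size_map size_enum_ord -lt0n (leq_trans _ hn).
case: [seq sigma i | i <- _] => [//|i t] _ /=.
by apply: (integrates_to_glue mu K0 I0 muK) => f; exact: (s2valP (TE i)).
Qed.
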